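(* Let $q=p^a$ be a prime power, let $\omega$ be a primitive element of $\mathbb{F}_q$ (a generator of $\mathbb{F}_q^*$), let $h\ge 1$, let $\lambda_1<\lambda_2<\cdots<\lambda_h$ and $l_1,\ldots,l_h$ be positive integers, and let $\mathbb{F}_q[t]_\lambda$ be the algebra defined in the context. Then the unit group $\mathbb{F}_q[t]_\lambda^*$ is generated by the following elements: (1) $\mathtt{a}_i(y)$ for $1\le i\le h$, where $y$ runs over a generating set of ${\rm GL}_{l_i}(q)$ (regarded as the subgroup of constant matrices in ${\rm GL}_{l_i}(\mathbb{F}_q[t]_{\lambda_i})$); (2) $\mathtt{b}_i(\mu)$ for $1\le i\le h$, where $\mu$ runs over the set $\{1+\omega^j t^l : 0\le j\le [\mathbb{F}_q:\mathbb{F}_p],\ 1\le l\le \lambda_i-1\}$; (3) $\mathtt{c}_i^+$ and $\mathtt{c}_i^-$ for $1\le i\le h-1$.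
   Context: For a positive integer $s$ let $\mathbb{F}_q[t]_s=\mathbb{F}_q[t]/(t^s)$ (truncated polynomial algebra). The algebra $\mathbb{F}_q[t]_\lambda$ consists of $h\times h$ block matrices $A=(A_{ij})$, where $A_{ij}$ is an $l_i\times l_j$ matrix whose entries lie in $\mathbb{F}_q[t]_{\lambda_j}$, and, if $i<j$, are (residues of) polynomials divisible by $t^{\lambda_j-\lambda_i}$ (i.e. lie in $t^{\lambda_j-\lambda_i}\mathbb{F}_q[t]_{\lambda_j}$). Thus all entries in block column $j$ are residues modulo $t^{\lambda_j}$. Multiplication: lift all entries to polynomials, multiply as matrices over $\mathbb{F}_q[t]$, and reduce the entries of block column $j$ modulo $t^{\lambda_j}$; this is a well-defined associative $\mathbb{F}_q$-algebra (isomorphic to the centralizer in $M_n(\mathbb{F}_q)$, $n=\sum_i\lambda_il_i$, of the unipotent matrix that is a block diagonal sum of $l_i$ unipotent Jordan blocks of size $\lambda_i$ for each $i$), and $\mathbb{F}_q[t]_\lambda^*$ denotes its group of units. Elements: for $1\le i\le h$ and $y\in{\rm GL}_{l_i}(\mathbb{F}_q[t]_{\lambda_i})$, $\mathtt{a}_i(y)$ is the identity of $\mathbb{F}_q[t]_\lambda$ with the block $A_{ii}$ replaced by $y$; for a unit $\mu\in\mathbb{F}_q[t]_{\lambda_i}$, $\mathtt{b}_i(\mu)$ is the identity with $A_{ii}$ replaced by ${\rm diag}(\mu,1,\ldots,1)$; for $1\le i\le h-1$, $\mathtt{c}_i^+$ is the identity with the block $A_{i,i+1}$ replaced by the $l_i\times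 l_{i+1}$ matrix having $t^{\lambda_{i+1}-\lambda_i}$ in its bottom-left corner and $0$ elsewhere, and $\mathtt{c}_i^-$ is the identity with the block $A_{i+1,i}$ replaced by the $l_{i+1}\times l_i$ matrix having $1$ in its top-right corner and $0$ elsewhere. *)

(* Defs.v *)
From HB Require Import structures.
From mathcomp Require Import all_boot all_order all_algebra.
Set Implicit Arguments. Unset Strict Implicit. Unset Printing Implicit Defensive.
Import GRing.Theory.
Local Open Scope ring_scope.

Inductive gen_by {T : Type} (mul : T -> T -> T) (one : T) (C : T -> Prop)
    (S : T -> Prop) : T -> Prop :=
| gen_one : gen_by mul one C S one
| gen_S x : S x -> gen_by mul one C S x
| gen_mul x y : gen_by mul one C S x -> gen_by mul one C S y ->
    gen_by mul one C S (mul x y)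
| gen_inv x y : gen_by mul one C S x -> C y -> mul x y = one -> mul y x = one ->
    gen_by mul one C S y.

Section TruncAlg.
Variables (F : fieldType) (h : nat) (l lam : nat -> nat).

(* h x h block matrices, block (r,s) of size l r x l s, polynomial entries;
   blocks are indexed from 0 (block r here = block r+1 in the paper). *)
Definition talg := forall r s : 'I_h, 'M[{poly F}]_(l r, l s).

(* membership in F_q[t]_lambda: entries of block column s reduced mod t^(lam s),
   and divisible by t^(lam s - lam r) above the block diagonal *)
Definition in_talg (A : talg) : Prop :=
  forall (r s : 'I_h) u v,
    (size (A r s u v) <= lam s)%N /\
    ((r < s)%N -> 'X^(lam s - lam r) %| A r s u v).

Definition talg_mul (A B : talg) : talg :=
  fun r s => map_mx (fun p => p %% 'X^(lam s)) (\sum_(k < h) A r k *m B k s).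

Definition talg_one : talg :=
  fun r s => \matrix_(u, v) ((r == s) && (val u == val v))%:R.

Definition talg_unit (A : talg) : Prop :=
  in_talg A /\ exists B, in_talg B /\ talg_mul A B = talg_one /\ talg_mul B A = talg_one.

Definition mx_get (R : nmodType) m n (M : 'M[R]_(m, n)) (u v : nat) : R :=
  match insub u, insub v with Some a, Some b => M a b | _, _ => 0 end.

Definition talg_a (i : nat) (Y : 'M[{poly F}]_(l i)) : talg :=
  fun r s => \matrix_(u, v)
    (if (val r == i) && (val s == i) then mx_get Y u v
     else ((r == s) && (val u == val v))%:R).

Definition talg_b (i : nat) (mu : {poly F}) : talg :=
  @talg_a i (\matrix_(u, v) (if val u == val v then (if val u == 0%N then mu else 1) else 0)).

Definition talg_cplus (i : nat) : talg :=
  fun r s => \matrix_(u, v)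
    (((r == s) && (val u == val v))%:R +
     (if [&& val r == i, val s == i.+1, val u == (l r).-1 & val v == 0%N]
      then 'X^(lam s - lam r) else 0)).

Definition talg_cminus (i : nat) : talg :=
  fun r s => \matrix_(u, v)
    (((r == s) && (val u == val v))%:R +
     (if [&& val r == i.+1, val s == i, val u == 0%N & val v == (l s).-1]
      then 1 else 0)).

End TruncAlg.

(* Main.v *)
(** Lift the algebra to the subring R of M_n(F[t]), n = l_1 + ... + l_h, of the
matrices A with t^(lam_j - lam_i) | A_ij; it is the quotient of R by the ideal
of the matrices whose block column j is divisible by t^(lam_j).  Give the
monomial matrix t^k E_xy, with x in block r and y in block s, the weight
2k + r - s.  Weights add up under multiplication, those of R are nonnegative,
and matrices of large weight vanish in the quotient.  Hence the units congruent
to 1 modulo positive weight are products of elements whose leading term is a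
monomial.  The needed 1 + c t^k E_xy come from the generators by commutators
and by conjugation with diagonal matrices when x <> y; when x = y the w^j
(j <= a) span F additively, so 1 + w^j t^k E_xx suffice.  Finally, the constant
terms of the diagonal blocks of a unit are invertible, and dividing by them
makes the unit congruent to 1 modulo positive weight. *)

Require Import Defs.
From HB Require Import structures.
From mathcomp Require Import all_boot all_order all_algebra.
From mathcomp Require Import fingroup perm finfield zify ring.
From Stdlib Require Import FunctionalExtensionality.
Set Implicit Arguments. Unset Strict Implicit. Unset Printing Implicit Defensive.
Import GRing.Theory.
Local Open Scope ring_scope.

(** * Additive span of the powers of a primitive element *)

(** Among [w ^+ 0, ..., w ^+ a] some [w ^+ d] lies in the prime-field span of the lower powers. That
    span is then stable under multiplication by [w], so it contains every power of [w], hence all of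
    [F]. *)
Lemma additive_full (F : finFieldType) (p a : nat) (w : F) (C : F -> Prop) :
  p \in [pchar F] -> #|F| = (p ^ a)%N -> (#|F|.-1).-primitive_root w ->
  C 0 -> (forall x y, C x -> C y -> C (x + y)) ->
  (forall j, (j <= a)%N -> C (w ^+ j)) -> forall c, C c.
Proof.
move=> pF cardF wprim C0 CD Cw.
have p_pr : prime p := pcharf_prime pF.
(* [V d] is the additive monoid generated by the [w ^+ j] with [j < d], encoded as an intersection.
   In characteristic [p] it is a group, since [- x = x *+ p.-1]. *)
pose V d x := forall B : F -> Prop, B 0 -> (forall x y, B x -> B y -> B (x + y)) ->
  (forall j, (j < d)%N -> B (w ^+ j)) -> B x.
have V0 d : V d 0 by move=> B.
have VD d x y : V d x -> V d y -> V d (x + y).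
  by move=> Vx Vy B B0 BD Bw; exact: BD (Vx B B0 BD Bw) (Vy B B0 BD Bw).
have Vw d j : (j < d)%N -> V d (w ^+ j) by move=> ltjd B _ _; apply.
have VMn d x m : V d x -> V d (x *+ m).
  by move=> Vx; elim: m => [|m IH]; rewrite ?mulr0n // mulrS; apply: VD.
have VN d x : V d x -> V d (- x).
  move=> Vx; have := VMn _ _ p.-1 Vx; suff -> : x *+ p.-1 = - x by [].
  apply/eqP; rewrite -addr_eq0 -mulrSr prednK ?prime_gt0 //.
  by rewrite -mulr_natr pcharf0 // mulr0.
have VB d x y : V d x -> V d y -> V d (x - y) by move=> Vx Vy; apply: VD => //; apply: VN.
have Vsum d (I : finType) (P : pred I) (f : I -> F) :
    (forall i, P i -> V d (f i)) -> V d (\sum_(i | P i) f i).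
  by move=> Vf; apply: (big_ind (V d)) => // x y; apply: VD.
(* Pigeonhole: p ^ (a + 1) digit vectors, but only p ^ a sums. *)
have [d led Vwd] : exists2 d, (d <= a)%N & V d (w ^+ d).
  pose f (c : {ffun 'I_a.+1 -> 'I_p}) := \sum_(j < a.+1) w ^+ j *+ c j.
  have /injectivePn[c [c' neqcc' fcc']] : ~~ injectiveb f.
    apply/negP => /injectiveP finj; have := leq_card f finj.
    rewrite card_ffun !card_ord cardF leq_exp2l ?prime_gt1 //.
    by rewrite ltnn.
  have /existsP[j0 neqj0] : [exists j, c j != c' j].
    apply: contraNT neqcc' => /existsPn eqcc'; apply/eqP/ffunP => j.
    by apply/eqP; apply: negbNE.
  (* Take for [d] the last index where the digit vectors differ, and swap them if needed so that [c]
     has the larger digit there. *)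
  wlog: c c' neqcc' fcc' j0 neqj0 / exists2 d : 'I_a.+1, (c' d < c d)%N &
       forall j : 'I_a.+1, (d < j)%N -> c j = c' j.
    move=> WL; case: (@arg_maxnP _ j0 (fun j => c j != c' j) val neqj0) => d neqd dmax.
    have eqd (j : 'I_a.+1) : (d < j)%N -> c j = c' j.
      move=> ltdj; apply/eqP; apply: contraLR ltdj => /dmax /=.
      by rewrite -leqNgt.
    have := neqd; rewrite -val_eqE neq_ltn => /orP[lt|lt]; last first.
      by apply: (WL c c' _ _ j0) => //; exists d.
    apply: (WL c' c _ _ j0) => //; rewrite 1?eq_sym //.
    by exists d => // j /eqd.
  case=> d ltcd eqd; exists d; first by rewrite -ltnS.
  have Vm : V d (w ^+ d *+ (c d - c' d)).
    have -> : w ^+ d *+ (c d - c' d) =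
        \sum_(j | j != d) (w ^+ j *+ c' j - w ^+ j *+ c j).
      move: fcc'; rewrite /f (bigD1 d) //= [in RHS](bigD1 d) //=.
      rewrite mulrnBr 1?ltnW // sumrB => /eqP; rewrite addrC -subr_eq => /eqP eq1.
      by rewrite -eq1; ring.
    apply: Vsum => j neqjd; case: (ltngtP j d) => [ltjd|/eqd ->|/val_inj eqjd].
    - by apply: VB; apply: VMn; apply: Vw.
    - by rewrite subrr.
    - by rewrite eqjd eqxx in neqjd.
  (* The multiplier lies strictly between [0] and [p], so a Bezout relation recovers [w ^+ d] from
     its multiple. *)
  have cop : coprime (c d - c' d) p.
    rewrite coprime_sym prime_coprime // gtnNdvd ?subn_gt0 //.
    by rewrite (leq_ltn_trans (leq_subr _ _)).
  have m_gt0 : (0 < c d - c' d)%N by rewrite subn_gt0.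
  case: (egcdnP p m_gt0) => km kn def_km _.
  rewrite (eqP cop) in def_km.
  have := VMn _ _ km Vm; rewrite -mulrnA mulnC def_km mulrnDr mulr1n.
  by rewrite mulnC mulrnA -[_ *+ p]mulr_natr pcharf0 // mulr0 mul0rn add0r.
have Vwall j : V d (w ^+ j).
  elim: j => [|j IH].
    case: d {led} Vwd => [V1|d _]; last exact: Vw.
    exact: V1.
  (* The preimage of [V d] under multiplication by [w] is additively closed and contains the
     generators of [V d], the last one thanks to [Vwd]. *)
  pose B x := V d (w * x).
  have /(_ B) := IH; rewrite /B exprS; apply; first by rewrite mulr0.
    by move=> x y; rewrite mulrDr; apply: VD.
  move=> i ltid; rewrite -exprS; move: ltid; rewrite leq_eqVlt => /orP[/eqP->//|].
  exact: Vw.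
move=> c; have [->//|c0] := eqVneq c 0.
have c1 : c ^+ #|F|.-1 = 1.
  have F_gt0 : (0 < #|F|)%N by apply/card_gt0P; exists 0.
  by apply: (mulfI c0); rewrite mulr1 -exprS prednK // expf_card.
case: (prim_rootP wprim c1) => i ->.
apply: (Vwall i) => // j ltjd; apply: Cw; lia.
Qed.

(** * Graded matrices and elementary matrices *)

Section GradedMatrices.
Variables (F : fieldType) (n : nat) (al : nat) (rho : 'I_n -> nat).
Implicit Types A B : 'M[{poly F}]_n.

(** The weight of [t^k E_xy] is [al * k + rho x - rho y]; the bound is written without subtraction.
    The data [1, lam] with [m = 0] give the algebra before truncation, the data [2, blk] the
    filtration for successive approximation. *)
Definition wt m A := forall x y k, (al * k + rho x < m + rho y)%N -> (A x y)`_k = 0.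

Lemma wt_le m m' A : (m' <= m)%N -> wt m A -> wt m' A.
Proof. by move=> le_m wA x y k lt_k; apply: wA; lia. Qed.

Lemma wtD m A B : wt m A -> wt m B -> wt m (A + B).
Proof. by move=> wA wB x y k lt_k; rewrite mxE coefD wA ?wB ?addr0. Qed.

Lemma wtN m A : wt m A -> wt m (- A).
Proof. by move=> wA x y k lt_k; rewrite mxE coefN wA ?oppr0. Qed.

Lemma wtB m A B : wt m A -> wt m B -> wt m (A - B).
Proof. by move=> wA wB; apply: wtD => //; apply: wtN. Qed.

(** In a product of [t^j E_xz] and [t^(k-j) E_zy] the term [rho z] cancels, so if the total weight
    is too small, one factor has too small a weight. *)
Lemma wtM m m' A B : wt m A -> wt m' B -> wt (m + m') (A *m B).
Proof.
move=> wA wB x y k lt_k; rewrite mxE coef_sum big1 // => z _.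
rewrite coefM big1 // => j _; have := ltn_ord j.
have [lt_j|ge_j] := ltnP (al * j + rho x)%N (m + rho z)%N.
  by rewrite wA ?mul0r.
move=> le_jk; rewrite wB ?mulr0 // mulnBr.
have := leq_mul (leqnn al) le_jk; lia.
Qed.

Lemma wt1 : wt 0 1%:M.
Proof.
move=> x y k lt_k; rewrite mxE; have [eqxy|_] := eqVneq x y; last by rewrite mulr0n coef0.
by move: lt_k; rewrite eqxy; lia.
Qed.

Lemma wt_delta m x y (f : {poly F}) :
  (forall k, (al * k + rho x < m + rho y)%N -> f`_k = 0) -> wt m (f *: delta_mx x y).
Proof.
move=> f0 x' y' k lt_k; rewrite !mxE.
have [eqx|_] := eqVneq x' x; last by rewrite mulr0 coef0.
have [eqy|_] := eqVneq y' y; last by rewrite mulr0 coef0.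
by rewrite mulr1; apply: f0; rewrite -eqx -eqy.
Qed.

End GradedMatrices.

Section Transvections.
Variables (R : comNzRingType) (n : nat).
Implicit Types (x y z : 'I_n) (f g : R).

(** The case [x = y] is allowed and gives a diagonal matrix with entry [1 + f] at [x]. *)
Definition elem x y f : 'M[R]_n := 1%:M + f *: delta_mx x y.

Lemma elemM x y x' y' f g :
  elem x y f *m elem x' y' g =
  1%:M + f *: delta_mx x y + g *: delta_mx x' y' + ((f * g) *+ (y == x')) *: delta_mx x y'.
Proof.
rewrite /elem mulmxDl mul1mx mulmxDr mulmx1 -scalemxAl -scalemxAr scalerA.
rewrite mul_delta_mx_cond; case: (y == x'); rewrite ?mulr1n ?mulr0n ?scaler0 ?scale0r.
  by rewrite addrA (addrAC 1%:M).
by rewrite !addr0 addrAC.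
Qed.

Lemma elem0 x y : elem x y 0 = 1%:M.
Proof. by rewrite /elem scale0r addr0. Qed.

Lemma elemD x y f g : x != y -> elem x y f *m elem x y g = elem x y (f + g).
Proof.
by rewrite elemM eq_sym => /negPf->; rewrite mulr0n scale0r addr0 /elem scalerDl addrA.
Qed.

Lemma elemNK x y f : x != y -> elem x y f *m elem x y (- f) = 1%:M.
Proof. by move=> neq; rewrite elemD // subrr elem0. Qed.

Lemma elem_diagM x f g : elem x x f *m elem x x g = elem x x (f + g + f * g).
Proof. by rewrite elemM eqxx /elem !scalerDl !addrA. Qed.

(** Conjugation by a diagonal matrix, written without an inverse because [1 + f] need not be a unit
    of [R]. *)
Lemma elem_scale x y f g : x != y ->
  elem x x f *m elem x y g = elem x y (g + f * g) *m elem x x f.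
Proof.
move=> neq; rewrite !elemM eqxx (negPf (_ : y != x)) 1?eq_sym //.
by rewrite mulr0n scale0r addr0 mulr1n [RHS]addrAC scalerDl !addrA.
Qed.

(** The Steinberg commutator relation, with the inverses written as negated parameters. *)
Lemma elem_comm x y z f g : x != y -> x != z -> z != y ->
  elem x z f *m elem z y g *m elem x z (- f) *m elem z y (- g) = elem x y (f * g).
Proof.
move=> xy xz zy.
have E : elem x z f *m elem z y g = elem x y (f * g) *m elem z y g *m elem x z f.
  rewrite !elemM eqxx mulr1n.
  have [/negPf yx /negPf zx] : (y != x) /\ (z != x) by rewrite ![_ == x]eq_sym.
  have /negPf yz : y != z by rewrite eq_sym.
  rewrite yz mulr0n scale0r addr0.
  rewrite /elem mulmxDr mulmx1 -scalemxAr 2!mulmxDl mul1mx -!scalemxAl.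
  rewrite !mul_delta_mx_cond yx mulr0n !scaler0 !addr0.
  by rewrite [RHS]addrAC (addrAC 1%:M _ (f *: _)) [RHS]addrAC.
rewrite E -(mulmxA _ (elem x z f)) elemNK // mulmx1 -mulmxA elemNK //.
by rewrite mulmx1.
Qed.

End Transvections.

(** * Generation inside the idealizer *)

Section FlatGeneration.
Variables (F : finFieldType) (n : nat) (lam blk : 'I_n -> nat).
Local Notation M := 'M[{poly F}]_n.
Implicit Types (x y z : 'I_n) (A B : M) (f g u : {poly F}).

(* The endomorphisms of the module of rows with entries in F[t] / t^(lam x), and
   those that act as zero. *)
Definition idealizer A := wt 1 lam 0 A.
Definition null A := forall x y k, (k < lam y)%N -> (A x y)`_k = 0.

Hypothesis lam_blk : forall x y, (blk x <= blk y)%N -> (lam x + blk y <= lam y + blk x)%N.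

Lemma nullD A B : null A -> null B -> null (A + B).
Proof. by move=> nA nB x y k ltk; rewrite mxE coefD nA ?nB ?addr0. Qed.

Lemma nullN A : null A -> null (- A).
Proof. by move=> nA x y k ltk; rewrite mxE coefN nA ?oppr0. Qed.

Lemma nullMl A B : null B -> null (A *m B).
Proof.
move=> nB x y k ltk; rewrite mxE coef_sum big1 // => z _.
rewrite coefM big1 // => j _; rewrite nB ?mulr0 //.
by rewrite (leq_ltn_trans (leq_subr _ _)).
Qed.

(** For degree [j] in the left factor, either [j < lam z] and that factor vanishes, or the remaining
    degree is too small for an entry of the idealizer at [(z, y)]. *)
Lemma nullMr A B : null A -> idealizer B -> null (A *m B).
Proof.
move=> nA wB x y k ltk; rewrite mxE coef_sum big1 // => z _.
rewrite coefM big1 // => j _; have := ltn_ord j.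
have [lt_j|ge_j] := ltnP j (lam z); first by rewrite nA ?mul0r.
by move=> lejk; rewrite wB ?mulr0 //; lia.
Qed.

Lemma null_idealizer A : null A -> idealizer A.
Proof. by move=> nA x y k ltk; apply: nA; lia. Qed.

Lemma null0 : null 0.
Proof. by move=> x y k _; rewrite mxE coef0. Qed.

(** By [lam_blk] the gap in [lam] is at least the gap in [blk], so [2 * k + blk x < blk y] forces
    [k + lam x < lam y]. *)
Lemma idealizer_wt A : idealizer A -> wt 2 blk 0 A.
Proof.
move=> wA x y k ltk; apply: wA; have := @lam_blk x y; lia.
Qed.

Lemma idealizer_elem x y f :
  (forall k, (k + lam x < lam y)%N -> f`_k = 0) -> idealizer (elem x y f).
Proof.
move=> f0; apply: wtD; first exact: wt1.
by apply: wt_delta => k; rewrite mul1n; apply: f0.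
Qed.

Lemma idealizer_elem_diag x f : idealizer (elem x x f).
Proof. by apply: idealizer_elem => k; lia. Qed.

Lemma null_elem x y f : (forall k, (k < lam y)%N -> f`_k = 0) -> null (f *: delta_mx x y).
Proof.
move=> f0 x' y' k ltk; rewrite !mxE; have [eqy|] := eqVneq y' y; last by rewrite andbF mulr0 coef0.
by rewrite mulr_natr coefMn f0 ?mul0rn -?eqy.
Qed.

Definition block_diag (Z : 'M[F]_n) := forall x y, blk x != blk y -> Z x y = 0.

Lemma lam_eq x y : blk x = blk y -> lam x = lam y.
Proof. by move=> e; have := @lam_blk x y; have := @lam_blk y x; lia. Qed.

Lemma neq_blk x y : blk x != blk y -> x != y.
Proof. by apply: contraNneq => ->. Qed.

Lemma block_diag1 : block_diag 1%:M.
Proof. by move=> x y neq; rewrite mxE (negPf (neq_blk neq)). Qed.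

Lemma block_diag_elem x y c : blk x = blk y -> block_diag (elem x y c).
Proof.
move=> eqb x' y' neq; rewrite mxE block_diag1 // add0r !mxE.
have [ex|] := eqVneq x' x; last by rewrite mulr0.
have [ey|] := eqVneq y' y; last by rewrite mulr0.
by rewrite ex ey eqb eqxx in neq.
Qed.

Lemma idealizer_const Z : block_diag Z -> idealizer (map_mx polyC Z).
Proof.
move=> bZ x y k; rewrite mul1n add0n mxE => ltk.
rewrite bZ ?polyC0 ?coef0 //; apply/eqP => /lam_eq; lia.
Qed.

(** * Predicates closed under products, inverses and congruence modulo [null] *)

Variable P : M -> Prop.
Hypothesis P1 : P 1%:M.
Hypothesis PM : forall A B, idealizer A -> idealizer B -> P A -> P B -> P (A *m B).
Hypothesis PE : forall A B, null (A - B) -> P A -> P B.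
Hypothesis PV : forall A B, idealizer A -> idealizer B -> null (A *m B - 1%:M) ->
  null (B *m A - 1%:M) -> P A -> P B.

(** Keeping an inverse modulo [null] next to [A] makes commutators and cancellation available; [PV]
    alone requires an inverse to be exhibited each time. *)
Definition Pu A := [/\ idealizer A, P A & exists B,
  [/\ idealizer B, P B, null (A *m B - 1%:M) & null (B *m A - 1%:M)]].

Lemma PuI A B : idealizer A -> idealizer B -> null (A *m B - 1%:M) ->
  null (B *m A - 1%:M) -> P A -> Pu A.
Proof. by move=> wA wB nAB nBA pA; split=> //; exists B; split=> //; apply: PV pA. Qed.

Lemma PuV A B : idealizer A -> idealizer B -> null (A *m B - 1%:M) ->
  null (B *m A - 1%:M) -> P A -> Pu B.
Proof. by move=> wA wB nAB nBA pA; apply: (@PuI B A) => //; apply: PV pA. Qed.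

Lemma PuIeq A B : idealizer A -> idealizer B -> A *m B = 1%:M -> B *m A = 1%:M -> P A -> Pu A.
Proof. by move=> wA wB AB BA; apply: (PuI wA wB); rewrite ?AB ?BA subrr; apply: null0. Qed.

Lemma nullM_1 A A' B B' : idealizer A' -> idealizer B' ->
  null (A *m A' - 1%:M) -> null (B *m B' - 1%:M) ->
  null (A *m B *m (B' *m A') - 1%:M).
Proof.
move=> wA' wB' nA nB; have -> : A *m B *m (B' *m A') - 1%:M =
    A *m ((B *m B' - 1%:M) *m A') + (A *m A' - 1%:M).
  by rewrite mulmxBl mul1mx mulmxBr !mulmxA addrA subrK.
by apply: nullD => //; apply: nullMl; apply: nullMr.
Qed.

Lemma PuM A B : Pu A -> Pu B -> Pu (A *m B).
Proof.
move=> [wA pA [A' [wA' pA' nA nA']]] [wB pB [B' [wB' pB' nB nB']]].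
split; [exact: (wtM wA wB) | exact: PM | exists (B' *m A'); split].
- exact: (wtM wB' wA').
- exact: PM.
- exact: nullM_1.
- exact: nullM_1.
Qed.

Lemma Pu1 : Pu 1%:M.
Proof. by apply: (PuIeq (B := 1%:M)); rewrite ?mulmx1 //; apply: wt1. Qed.

Lemma PuE A B : null (A - B) -> Pu A -> Pu B.
Proof.
move=> nAB [wA pA [A' [wA' pA' nA nA']]].
have wB : idealizer B.
  have -> : B = A - (A - B) by rewrite opprB addrC subrK.
  by apply: wtB => //; apply: null_idealizer.
have eqn (X Y : M) : null (X - Y) -> null (X - 1%:M) -> null (Y - 1%:M).
  move=> nXY nX; have -> : Y - 1%:M = (X - 1%:M) - (X - Y).
    by rewrite opprB [RHS]addrC addrA subrK.
  by apply: nullD => //; apply: nullN.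
apply: (@PuI _ A') => //; last exact: PE pA.
  by apply: (eqn (A *m A')) => //; rewrite -mulmxBl; apply: nullMr.
by apply: (eqn (A' *m A)) => //; rewrite -mulmxBr; apply: nullMl.
Qed.

Lemma Pu_cancelr A B : idealizer A -> Pu B -> Pu (A *m B) -> Pu A.
Proof.
move=> wA [wB pB [B' [wB' pB' nB nB']]] pAB.
have pB'u : Pu B' by apply: (@PuI _ B).
apply: PuE (PuM pAB pB'u).
have -> : A *m B *m B' - A = A *m (B *m B' - 1%:M) by rewrite mulmxBr mulmx1 mulmxA.
exact: nullMl.
Qed.

Lemma Pu_elemN x y f : x != y -> Pu (elem x y f) -> Pu (elem x y (- f)).
Proof.
move=> neq [wE pE _]; have wE' : idealizer (elem x y (- f)).
  have -> : elem x y (- f) = 1%:M + 1%:M - elem x y f.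
    by rewrite /elem scaleNr opprD addrA addrK.
  by apply: wtB => //; apply: wtD; apply: wt1.
apply: (PuV wE wE') => //; first by rewrite elemNK // subrr; apply: null0.
by rewrite -{2}(opprK f) elemNK // subrr; apply: null0.
Qed.

Lemma Pu_elem_scale1 x y f g : x != y -> Pu (elem x x f) -> Pu (elem x y g) ->
  Pu (elem x y (g + f * g)).
Proof.
move=> neq pf pg; have [wE _ _] := pg.
have := PuM pf pg; rewrite elem_scale // => pfg.
apply: Pu_cancelr pf pfg.
have -> : elem x y (g + f * g) = elem x x f *m (elem x y g - 1%:M) + 1%:M.
  rewrite (_ : elem x y g - 1%:M = g *: delta_mx x y); last by rewrite /elem addrC addKr.
  by rewrite /elem mulmxDl mul1mx -scalemxAl -scalemxAr scalerA mul_delta_mx addrC scalerDl.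
apply: wtD; last exact: wt1.
apply: (@wtM _ _ _ _ 0 0); first exact: idealizer_elem_diag.
by apply: wtB => //; apply: wt1.
Qed.

(** Dividing the conjugate with parameter [g + f * g] by the original matrix leaves exactly
    [f * g]. *)
Lemma Pu_elem_scale x y f g : x != y -> Pu (elem x x f) -> Pu (elem x y g) ->
  Pu (elem x y (f * g)).
Proof.
move=> neq pf pg; have := PuM (Pu_elem_scale1 neq pf pg) (Pu_elemN neq pg).
by rewrite elemD // addrAC subrr add0r.
Qed.

Lemma Pu_elem_comm x y z f g : x != y -> x != z -> z != y ->
  Pu (elem x z f) -> Pu (elem z y g) -> Pu (elem x y (f * g)).
Proof.
move=> xy xz zy pf pg; rewrite -(elem_comm _ _ xy xz zy).
by do 3?[apply: PuM] => //; apply: Pu_elemN.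
Qed.

(** The inverse modulo [null] is the truncated geometric series: [1 + h] is that series, hence the
    [- 1] in [h]. *)
Lemma Pu_diag x g : P (elem x x (g * 'X)) -> Pu (elem x x (g * 'X)).
Proof.
set f := g * 'X => pf; pose h := \sum_(i < lam x) (- f) ^+ i - 1.
have E : f + h + f * h = - (- f) ^+ lam x.
  apply: (@addIr _ 1); rewrite [RHS]addrC -opprB subrX1 -opprD mulNr opprK /h.
  by ring.
have nE : null (elem x x (f + h + f * h) - 1%:M).
  rewrite /elem addrC addKr; apply: null_elem => k ltk.
  by rewrite E coefN -mulNr exprMn coefMXn ltk oppr0.
apply: (@PuI _ (elem x x h)) pf; rewrite ?elem_diagM //; do ?exact: idealizer_elem_diag.
by rewrite (addrC h) (mulrC h).
Qed.

(** * Elementary matrices with monomial entries from the generators *)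

Hypothesis lam_gt0 : forall x, (0 < lam x)%N.
Variables (p a : nat) (w : F).
Hypothesis pF : p \in [pchar F].
Hypothesis cardF : #|F| = (p ^ a)%N.
Hypothesis wprim : (#|F|.-1).-primitive_root w.
Hypothesis between : forall x y i, (blk x < i < blk y)%N -> exists z, blk z = i.

Hypothesis P_const : forall Z Z', block_diag Z -> block_diag Z' -> Z *m Z' = 1%:M ->
  P (map_mx polyC Z).
Hypothesis P_diag : forall x, exists2 x', blk x' = blk x &
  forall j e, (j <= a)%N -> (0 < e < lam x)%N -> P (elem x' x' (w ^+ j *: 'X^e)).
Hypothesis P_adjacent : forall x y, blk y = (blk x).+1 -> exists x' y',
  [/\ blk x' = blk x, blk y' = blk y, P (elem x' y' 'X^(lam y' - lam x')) & P (elem y' x' 1)].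

Lemma map_elem x y (c : F) : map_mx polyC (elem x y c) = elem x y c%:P.
Proof. by rewrite /elem map_mxD map_mx1 map_mxZ map_delta_mx. Qed.

Lemma Pu_const Z Z' : block_diag Z -> block_diag Z' -> Z *m Z' = 1%:M ->
  Pu (map_mx polyC Z).
Proof.
move=> bZ bZ' ZZ'; have Z'Z := mulmx1C ZZ'.
apply: (@PuIeq _ (map_mx polyC Z')); rewrite -?map_mxM ?ZZ' ?Z'Z ?map_mx1 //.
- exact: idealizer_const.
- exact: idealizer_const.
- exact: P_const ZZ'.
Qed.

Lemma Pu_elem_const x y c : x != y -> blk x = blk y -> Pu (elem x y c%:P).
Proof.
move=> neq eqb; rewrite -map_elem.
by apply: (@Pu_const _ (elem x y (- c))); rewrite ?elemNK //; apply: block_diag_elem.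
Qed.

Lemma Pu_diag_const x c : c != 0 -> Pu (elem x x (c - 1)%:P).
Proof.
move=> c0; rewrite -map_elem.
apply: (@Pu_const _ (elem x x (c^-1 - 1))); do ?exact: block_diag_elem.
rewrite elem_diagM -[RHS](elem0 _ x x); congr elem.
by field.
Qed.

Lemma elem_tperm x x' f :
  tperm_mx x x' *m elem x' x' f *m tperm_mx x x' = elem x x f :> M.
Proof.
rewrite /elem mulmxDr mulmx1 mulmxDl -perm_mxM tperm2 perm_mx1; congr (_ + _).
rewrite -scalemxAr -scalemxAl; congr (_ *: _).
rewrite -xrowE -xcolE; apply/matrixP => i j; rewrite !mxE.
have tE k : (tperm x x' k == x') = (k == x).
  by rewrite -{2}(tpermL x x') (inj_eq perm_inj).
by rewrite !tE.
Qed.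

(** [P_diag] serves one index of each block; conjugation by a transposition inside the block, a
    constant matrix, reaches the others. For [e >= lam x] the matrix is [1] modulo [null]. *)
Lemma Pu_diag_mono x j e : (j <= a)%N -> (0 < e)%N -> Pu (elem x x (w ^+ j *: 'X^e)).
Proof.
move=> lej e_gt0; have [lt_e|le_e] := ltnP e (lam x); last first.
  apply: PuE Pu1; rewrite /elem opprD addrA subrr add0r; apply: nullN.
  by apply: null_elem => k ltk; rewrite coefZ coefXn; case: eqP => [|_]; [lia | rewrite mulr0].
have [x' eqb Px'] := P_diag x; rewrite -(elem_tperm x x').
have tpermE : tperm_mx x x' = map_mx polyC (tperm_mx x x') :> M by rewrite map_perm_mx.
have Pt : Pu (tperm_mx x x').
  have bt : block_diag (tperm_mx x x').
    move=> y z neq; rewrite !mxE; case: eqP => // ez; move: neq; rewrite -ez.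
    by case: tpermP => [->|->|]; rewrite ?eqb ?eqxx.
  rewrite tpermE; apply: (Pu_const bt bt).
  by rewrite -perm_mxM tperm2 perm_mx1.
apply: PuM => //; apply: PuM => //.
rewrite -(prednK e_gt0) exprSr scalerAl; apply: Pu_diag.
by rewrite -scalerAl -exprSr prednK //; apply: Px'; rewrite ?e_gt0.
Qed.

(** The scalar [c] comes from conjugation by the constant diagonal entry [1 + (c - 1)], a positive
    power of [t] from [Pu_elem_scale] with the coefficient [w ^+ 0 = 1]. *)
Lemma Pu_elem_mono x y g c k : x != y -> Pu (elem x y g) -> Pu (elem x y (c *: 'X^k * g)).
Proof.
move=> neq pg; have [->|c0] := eqVneq c 0.
  by rewrite scale0r mul0r elem0; apply: Pu1.
have pcg : Pu (elem x y (c%:P * g)).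
  have -> : c%:P * g = g + (c - 1)%:P * g by rewrite polyCB; ring.
  by apply: Pu_elem_scale1 => //; apply: Pu_diag_const.
case: k => [|k]; first by rewrite expr0 alg_polyC.
have -> : c *: 'X^(k.+1) * g = (w ^+ 0 *: 'X^(k.+1)) * (c%:P * g).
  by rewrite expr0 scale1r -mul_polyC; ring.
by apply: Pu_elem_scale => //; apply: Pu_diag_mono.
Qed.

(** The subtraction is truncated, so the exponent is the least one that the idealizer admits at
    [(x, y)], namely [0] when [lam y <= lam x]. *)
Definition minimal x y := Pu (elem x y 'X^(lam y - lam x)).

Lemma minimal_trans x y z : x != y -> x != z -> z != y ->
  (lam z - lam x + (lam y - lam z) = lam y - lam x)%N ->
  minimal x z -> minimal z y -> minimal x y.
Proof.
by move=> xy xz zy e pxz pzy; rewrite /minimal -e exprD; apply: (Pu_elem_comm xy xz zy).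
Qed.

Lemma minimal_block x y : x != y -> blk x = blk y -> minimal x y.
Proof.
by move=> neq eqb; rewrite /minimal (lam_eq eqb) subnn expr0; apply: Pu_elem_const.
Qed.

(** Commutators with constant elementary matrices inside a block move each endpoint, so one pair of
    indices per pair of blocks suffices. *)
Lemma minimal_move x y x' y' : blk x' = blk x -> blk y' = blk y -> blk x != blk y ->
  minimal x' y' -> minimal x y.
Proof.
move=> ex ey neq pxy; have ly := lam_eq ey; have lx := lam_eq ex.
have {}pxy : minimal x y'.
  have [->//|neqx] := eqVneq x x'.
  apply: (minimal_trans _ neqx _ _ _ pxy); do ?[apply: neq_blk; rewrite ?ex ?ey //].
    by rewrite lx subnn.
  exact: minimal_block.
have [->//|neqy] := eqVneq y y'; rewrite eq_sym in neqy.
apply: (minimal_trans _ _ neqy _ pxy); do ?[apply: neq_blk; rewrite ?ex ?ey //].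
  by rewrite ly subnn addn0.
exact: minimal_block.
Qed.

Lemma minimal_adjacent x y : blk y = (blk x).+1 -> minimal x y /\ minimal y x.
Proof.
move=> eqb; have [x' [y' [ex ey pxy pyx]]] := P_adjacent eqb.
have neq : blk x != blk y by apply/eqP; lia.
have neq' : x' != y' by apply: neq_blk; rewrite ex ey.
have le_lam := @lam_blk x' y'.
have pu (u v : 'I_n) f : u != v -> P (elem u v f) ->
    (forall i, (i + lam u < lam v)%N -> f`_i = 0) -> Pu (elem u v f).
  move=> nuv puv f0; apply: (@PuIeq _ (elem u v (- f))) => //; rewrite ?elemNK //.
  - exact: idealizer_elem.
  - by apply: idealizer_elem => i lti; rewrite coefN f0 ?oppr0.
  - by rewrite -{2}(opprK f) elemNK.
split.
  apply: (minimal_move ex ey neq); apply: pu => // i lti.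
  by rewrite coefXn; case: eqP => //; lia.
rewrite eq_sym in neq; apply: (minimal_move ey ex neq).
have -> : minimal y' x' = Pu (elem y' x' 1).
  by rewrite /minimal (_ : lam x' - lam y' = 0)%N ?expr0 //; lia.
by apply: pu => //; [rewrite eq_sym | move=> i; lia].
Qed.

(** Pass through an index of the next block: as [lam] is monotone in the block, the least exponents
    add up on the way up and are all [0] on the way down. *)
Lemma minimal_dist k x y : blk y = (blk x + k.+1)%N -> minimal x y /\ minimal y x.
Proof.
elim: k x => [|k IH] x eqb; first by apply: minimal_adjacent; rewrite eqb addn1.
have [|z ez] := @between x y (blk x).+1; first by lia.
have [pxz pzx] := minimal_adjacent ez.
have [|pzy pyz] := IH z; first by rewrite ez eqb; lia.
have xz : x != z by apply: neq_blk; apply/eqP; lia.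
have zy : z != y by apply: neq_blk; apply/eqP; lia.
have xy : x != y by apply: neq_blk; apply/eqP; lia.
have lxz := @lam_blk x z; have lzy := @lam_blk z y.
split; first by apply: (minimal_trans xy xz zy) => //; lia.
by apply: (minimal_trans _ _ _ _ pyz pzx); rewrite 1?eq_sym //; lia.
Qed.

Lemma minimal_all x y : x != y -> minimal x y.
Proof.
move=> neq; have [lt|lt|] := ltngtP (blk x) (blk y); last exact: minimal_block.
- by case: (@minimal_dist (blk y - blk x).-1 x y) => //; lia.
- by case: (@minimal_dist (blk x - blk y).-1 y x) => //; lia.
Qed.

(** * Leading terms and successive approximation *)

Definition leading m (N : M) := exists2 A, Pu A & wt 2 blk m.+1 (A - 1%:M - N).

Lemma leading0 m N : wt 2 blk m.+1 N -> leading m N.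
Proof. by move=> wN; exists 1%:M; [exact: Pu1 | rewrite subrr add0r; apply: wtN]. Qed.

Lemma leadingE m N N' : wt 2 blk m.+1 (N - N') -> leading m N -> leading m N'.
Proof.
move=> wNN [A pA wA]; exists A => //.
have -> : A - 1%:M - N' = (A - 1%:M - N) + (N - N') by rewrite addrA subrK.
exact: wtD.
Qed.

(** The product of the two deviations from [1] has weight [2 * m], which is at least [m.+1]; so
    multiplying the units adds their leading terms. *)
Lemma leadingD m N N' : (0 < m)%N -> wt 2 blk m N -> wt 2 blk m N' ->
  leading m N -> leading m N' -> leading m (N + N').
Proof.
move=> m_gt0 wN wN' [A pA wA] [A' pA' wA']; exists (A *m A'); first exact: PuM.
have wB : wt 2 blk m (A - 1%:M).
  by rewrite -(subrK N (_ - _)); apply: wtD => //; apply: wt_le wA.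
have wB' : wt 2 blk m (A' - 1%:M).
  by rewrite -(subrK N' (_ - _)); apply: wtD => //; apply: wt_le wA'.
have -> : A *m A' - 1%:M - (N + N') =
    (A - 1%:M) *m (A' - 1%:M) + ((A - 1%:M - N) + (A' - 1%:M - N')).
  rewrite mulmxBl mul1mx mulmxBr mulmx1.
  by move: (A *m A') => AA; apply/matrixP => i j; rewrite !mxE; ring.
apply: wtD; last exact: wtD.
by apply: wt_le (wtM wB wB'); lia.
Qed.

(** Off the diagonal one elementary matrix is enough. On the diagonal only the coefficients [w ^+ j]
    are at hand, and additivity of leading terms with [additive_full] gives the rest. *)
Lemma leading_mono m x y c k : (0 < m)%N -> (2 * k + blk x = m + blk y)%N ->
  (lam y <= k + lam x)%N -> leading m ((c *: 'X^k) *: delta_mx x y).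
Proof.
move=> m_gt0 eqk lek; have [exy|neq] := eqVneq x y; last first.
  exists (elem x y (c *: 'X^k)); last first.
    by rewrite /elem [1%:M + _]addrC addrK subrr => x' y' k' _; rewrite mxE coef0.
  have -> : c *: 'X^k = c *: 'X^(k - (lam y - lam x)) * 'X^(lam y - lam x) :> {poly F}.
    by rewrite -scalerAl -exprD subnK //; lia.
  by apply: Pu_elem_mono => //; apply: minimal_all.
move: {lek} eqk; rewrite -{y}exy => eqk; have k_gt0 : (0 < k)%N by lia.
have wm c' : wt 2 blk m ((c' *: 'X^k) *: delta_mx x x).
  apply: wt_delta => i lti; rewrite coefZ coefXn; case: eqP => [|_]; [lia | exact: mulr0].
apply: (@additive_full _ _ _ _ (fun c => leading m ((c *: 'X^k) *: delta_mx x x)) pF cardF wprim).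
- by rewrite !scale0r; apply: leading0 => x' y' k' _; rewrite mxE coef0.
- by move=> c1 c2 h1 h2; rewrite !scalerDl; apply: leadingD.
- move=> j lej; exists (elem x x (w ^+ j *: 'X^k)); first exact: Pu_diag_mono.
  by rewrite /elem [1%:M + _]addrC addrK subrr => x' y' k' _; rewrite mxE coef0.
Qed.

Lemma leading_delta m x y f : (0 < m)%N ->
  (forall k, (2 * k + blk x < m + blk y)%N -> f`_k = 0) ->
  (forall k, (k + lam x < lam y)%N -> f`_k = 0) ->
  leading m (f *: delta_mx x y).
Proof.
(* [k] is the only degree that can have weight exactly [m] at [(x, y)]. If halving or truncated
   subtraction spoils the equation, [f] already has weight [m.+1] there. *)
move=> m_gt0 wf lf; pose k := ((m + blk y - blk x)./2)%N.
have [eqk|neqk] := eqVneq (2 * k + blk x)%N (m + blk y)%N; last first.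
  apply: leading0; apply: wt_delta => i lti; apply: wf.
  by move: neqk; rewrite /k; lia.
have [lt_k|le_k] := ltnP (k + lam x) (lam y).
  apply: leading0; apply: wt_delta => i lti.
  have [->|neqik] := eqVneq i k; first exact: lf.
  by apply: wf; lia.
apply: leadingE (leading_mono f`_k m_gt0 eqk le_k).
rewrite -scalerBl; apply: wt_delta => i lti.
rewrite coefB coefZ coefXn; have [->|neqik] := eqVneq i k; first by rewrite mulr1 subrr.
by rewrite mulr0 wf ?subrr //; lia.
Qed.

Lemma leading_all m N : (0 < m)%N -> idealizer N -> wt 2 blk m N -> leading m N.
Proof.
move=> m_gt0 lN wN; rewrite (matrix_sum_delta N).
have wd x y : wt 2 blk m (N x y *: delta_mx x y) by apply: wt_delta => k; apply: wN.
suff [] : wt 2 blk m (\sum_x \sum_y N x y *: delta_mx x y) /\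
  leading m (\sum_x \sum_y N x y *: delta_mx x y) by [].
pose K (A : M) := wt 2 blk m A /\ leading m A.
have K0 : K 0 by split; [|apply: leading0]; move=> x y k _; rewrite mxE coef0.
have KD A B : K A -> K B -> K (A + B).
  by move=> [wA lA] [wB lB]; split; [apply: wtD | apply: leadingD].
apply: (big_ind K) => // x _; apply: (big_ind K) => // y _.
split=> //; apply: leading_delta => // k; first exact: wN.
by move=> ltk; apply: lN; rewrite mul1n add0n.
Qed.

Lemma P_unipotent U : idealizer U -> wt 2 blk 1 (U - 1%:M) -> P U.
Proof.
(* A monomial [t^i E_xy] with [i < lam y] has weight below [2 * lam y + blk x], hence below [L]; so
   weight [L] implies [null]. *)
pose L := (\sum_x (2 * lam x) + \sum_x blk x)%N.
suff main k m V : (L <= k + m)%N -> (0 < m)%N -> idealizer V -> wt 2 blk m (V - 1%:M) -> P V.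
  by apply: (main L 1%N) => //; rewrite leq_addr.
elim: k m V => [|k IH] m V leL m_gt0 lV wV.
  apply: PE P1; rewrite -opprB; apply: nullN => x y i lti; apply: wV.
  have le1 : (2 * lam y <= \sum_z 2 * lam z)%N by rewrite (bigD1 y) //= leq_addr.
  have le2 : (blk x <= \sum_z blk z)%N by rewrite (bigD1 x) //= leq_addr.
  by move: leL; rewrite /L; lia.
have [A [lA pA [A' [lA' pA' nA nA']]] wA] := leading_all m_gt0 (wtB lV (@wt1 _ _ _ _)) wV.
(* [A'] inverts [A] only modulo [null], and null matrices may have low weight. Subtracting the
   defect makes [W - 1%:M] equal to [A' *m (V - A)] exactly, of weight [m.+1]. *)
pose W := A' *m V - (A' *m A - 1%:M).
have W1 : W - 1%:M = A' *m (V - A) by rewrite /W mulmxBr opprB [1%:M - _]addrC addrA addrK.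
have lW : idealizer W.
  apply: wtB; [exact: (wtM lA' lV) | exact: null_idealizer].
have pW : P W.
  apply: (IH m.+1) => //; first by lia.
  rewrite W1 -[m.+1]add0n; apply: wtM; first exact: idealizer_wt.
  have -> : V - A = - (A - 1%:M - (V - 1%:M)) by rewrite opprB opprB addrA subrK.
  exact: wtN.
apply: PE (PM lA lW pA pW).
have -> : A *m W - V = (A *m A' - 1%:M) *m V - A *m (A' *m A - 1%:M).
  by rewrite /W mulmxBr mulmxBl mul1mx mulmxA addrAC.
by apply: nullD; [apply: nullMr | apply: nullN; apply: nullMl].
Qed.

Theorem P_unit U B : idealizer U -> idealizer B -> null (U *m B - 1%:M) -> P U.
Proof.
move=> lU lB nUB.
pose res (A : M) : 'M[F]_n := \matrix_(x, y) (if blk x == blk y then (A x y)`_0 else 0).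
have res_diag A : block_diag (res A) by move=> x y /negPf neq; rewrite mxE neq.
(* Constant terms of diagonal blocks multiply: on a path through another block, one of the two
   factors lies above the block diagonal and has no constant term. *)
have coef0M A A' x y : idealizer A -> idealizer A' -> blk x = blk y ->
    ((A *m A') x y)`_0 = \sum_z res A x z * res A' z y.
  move=> lA lA' eqb; rewrite mxE coef_sum; apply: eq_bigr => z _.
  rewrite coefM big_ord1 /= !mxE -eqb [blk z == _]eq_sym.
  case: eqVneq => [//|neq]; rewrite mul0r.
  have l1 := @lam_blk x z; have l2 := @lam_blk z y.
  have [lt|lt|eqz] := ltngtP (blk x) (blk z); last by rewrite eqz eqxx in neq.
  - by rewrite lA ?mul0r //; lia.
  - by rewrite lA' ?mulr0 //; lia.
have resUB : res U *m res B = 1%:M.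
  apply/matrixP => x y; have [eqb|neq] := eqVneq (blk x) (blk y); last first.
    rewrite mxE big1 ?block_diag1 // => z _; rewrite !mxE.
    have [exz|_] := eqVneq (blk x) (blk z); last by rewrite mul0r.
    by rewrite -exz (negPf neq) mulr0.
  rewrite mxE -coef0M //.
  have := nUB x y 0%N (lam_gt0 y); rewrite mxE coefD => /eqP.
  rewrite addr_eq0 => /eqP->; rewrite !mxE coefN opprK.
  by case: (x == y); rewrite ?coef1 ?coef0.
have resBU := mulmx1C resUB.
have pu := Pu_const (res_diag U) (res_diag B) resUB.
set A := map_mx polyC (res U) in pu; pose A' := map_mx polyC (res B).
have lA' : idealizer A' by apply: idealizer_const.
have AA' : A *m A' = 1%:M by rewrite -map_mxM resUB map_mx1.
have -> : U = A *m (A' *m U) by rewrite mulmxA AA' mul1mx.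
have lA'U : idealizer (A' *m U) by apply: (wtM lA' lU).
have [lA pA _] := pu; apply: PM => //; apply: P_unipotent => //.
(* The factor 2 in the weight makes every off-diagonal monomial of the idealizer positive, so weight
   zero leaves only constants in diagonal blocks, which [A'] normalizes to [1]. *)
move=> x y k ltk; have [eqb|neq] := eqVneq (blk x) (blk y); last first.
  have lb := @lam_blk x y; have : idealizer (A' *m U - 1%:M) by apply: wtB => //; apply: wt1.
  by apply; lia.
have -> : k = 0%N by lia.
rewrite mxE coefD coef0M //.
have <- : (res B *m res U) x y = \sum_z res A' x z * res U z y.
  by rewrite mxE; apply: eq_bigr => z _; rewrite !mxE coefC eqxx; case: eqP.
by rewrite resBU !mxE; case: (x == y); rewrite coefN ?coef1 ?coef0 subrr.
Qed.

End FlatGeneration.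

(** * Flattening block matrices *)

Lemma dvdXnP (F : fieldType) d (q : {poly F}) :
  reflect (forall k, (k < d)%N -> q`_k = 0) ('X^d %| q).
Proof.
apply: (iffP idP) => [/dvdpP[q' ->] k ltk|q0]; first by rewrite coefMXn ltk.
rewrite /dvdp -Pdiv.IdomainMonic.take_poly_modp; apply/eqP/polyP => k.
by rewrite coef_take_poly coef0; case: ifP => // /q0.
Qed.

Section Flattening.
Variables (F : finFieldType) (h : nat) (l lam : nat -> nat).
Hypothesis lam_gt0 : forall i, (i < h)%N -> (0 < lam i)%N.
Hypothesis lam_mono : forall i j, (i <= j < h)%N -> (lam i + j <= lam j + i)%N.
Local Notation n := (\sum_(r < h) l r)%N.
Local Notation M := 'M[{poly F}]_n.
Local Notation sg x := (@tagnat.sig1 h (fun r : 'I_h => l r) x).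
Local Notation rk u := (@tagnat.Rank h (fun r : 'I_h => l r) _ u).
Local Notation blkx := (fun x : 'I_n => val (sg x)).
Local Notation lamx := (fun x : 'I_n => lam (sg x)).
Local Notation mulT := (@talg_mul F h l lam).
Implicit Types (A B : M) (X Y : talg F h l).

(** On the idealizer this is the quotient map by [null] onto the algebra, with [unred] as a
    section. *)
Definition red A : talg F h l :=
  fun r s => map_mx (fun q => q %% 'X^(lam s)) (submxblock A r s).

Definition unred X : M := mxblock X.

Lemma talgP X Y : (forall r s u v, X r s u v = Y r s u v) -> X = Y.
Proof.
move=> eqXY; apply: functional_extensionality_dep => r.
by apply: functional_extensionality_dep => s; apply/matrixP.
Qed.

Lemma redE A r s u v : red A r s u v = take_poly (lam s) (A (rk u) (rk v)).
Proof. by rewrite !mxE Pdiv.IdomainMonic.take_poly_modp. Qed.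

Lemma red_eq A B : null lamx (A - B) -> red A = red B.
Proof.
move=> nAB; apply: talgP => r s u v; rewrite !redE; apply/polyP => k.
rewrite !coef_take_poly; case: ifP => // ltk; apply/eqP; rewrite -subr_eq0.
have := nAB (rk u) (rk v) k; rewrite tagnat.Rank1K => /(_ ltk).
by rewrite !mxE coefB => ->.
Qed.

Lemma red_entries A X :
  (forall r s u v, A (rk u) (rk v) = X r s u v /\ (size (X r s u v) <= lam s)%N) ->
  red A = X.
Proof.
move=> AX; apply: talgP => r s u v; rewrite redE.
by have [-> le] := AX r s u v; rewrite take_poly_id.
Qed.

Lemma unredK X : in_talg lam X -> red (unred X) = X.
Proof.
move=> tX; apply: talgP => r s u v; rewrite mxE /unred mxblockK.
by rewrite -Pdiv.IdomainMonic.take_poly_modp take_poly_id //; case: (tX r s u v).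
Qed.

Lemma redK A : null lamx (unred (red A) - A).
Proof.
move=> x y k ltk; rewrite !mxE !tagnat.sig2K -Pdiv.IdomainMonic.take_poly_modp.
by rewrite coefB coef_take_poly ltk subrr.
Qed.

Lemma red_null A B : red A = red B -> null lamx (A - B).
Proof.
move=> eAB; rewrite (_ : A - B = (unred (red B) - B) - (unred (red A) - A)).
  by apply: nullD; [apply: redK | apply: nullN; apply: redK].
by rewrite eAB opprB [RHS]addrC addrA subrK.
Qed.

Lemma idealizer_unred X : in_talg lam X -> idealizer lamx (unred X).
Proof.
move=> tX x y k; rewrite mul1n add0n mxE => ltk.
have [ltxy|leyx] := ltnP (sg x) (sg y).
  by case: (tX (sg x) (sg y) (tagnat.sig2 x) (tagnat.sig2 y)) => _ /(_ ltxy)/dvdXnP; apply; lia.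
(* On and below the block diagonal there is nothing to check, since [lam] is monotone. *)
by have := @lam_mono (sg y) (sg x); rewrite leyx ltn_ord => /(_ isT); lia.
Qed.

Lemma in_talg_red A : idealizer lamx A -> in_talg lam (red A).
Proof.
move=> lA r s u v; rewrite redE; split; first exact: size_take_poly.
move=> ltrs; apply/dvdXnP => k ltk; rewrite coef_take_poly; case: ifP => // _.
by apply: lA; rewrite !tagnat.Rank1K; lia.
Qed.

Lemma talg_mulE X Y : mulT X Y = red (unred X *m unred Y).
Proof.
apply: functional_extensionality_dep => r; apply: functional_extensionality_dep => s.
by rewrite /red /unred mul_mxblock mxblockK.
Qed.

(** Only the right factor has to lie in the idealizer, because [null] absorbs arbitrary left
    factors. *)
Lemma talg_mul_red A B : idealizer lamx B -> mulT (red A) (red B) = red (A *m B).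
Proof.
move=> lB; rewrite talg_mulE; apply: red_eq.
have -> : unred (red A) *m unred (red B) - A *m B =
    unred (red A) *m (unred (red B) - B) + (unred (red A) - A) *m B.
  by rewrite mulmxBr mulmxBl addrA subrK.
by apply: nullD; [apply: nullMl; apply: redK | apply: nullMr => //; apply: redK].
Qed.

(** * Identity and generators as flat matrices *)

Lemma eq_rk (r s : 'I_h) (u : 'I_(l r)) (v : 'I_(l s)) :
  (rk u == rk v) = (r == s) && (val u == val v).
Proof. by rewrite -val_eqE tagnat.eq_Rank. Qed.

Lemma size_nat_lam (s : 'I_h) (b : bool) : (size (b%:R : {poly F}) <= lam s)%N.
Proof.
by apply: leq_trans (lam_gt0 (ltn_ord s)); case: b; rewrite ?size_poly1 ?size_poly0.
Qed.

Lemma talg_oneE : red 1%:M = @talg_one F h l.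
Proof.
apply: red_entries => r s u v; rewrite !mxE eq_rk; split=> //; exact: size_nat_lam.
Qed.

(** ['M_(l r)] and ['M_(l i)] are not convertible when [val r = i], so entries are read through
    [mx_get] instead of a transport. *)
Definition constant_block i (y : 'M[F]_(l i)) (r : 'I_h) : 'M[F]_(l r) :=
  if val r == i then \matrix_(u, v) mx_get y u v else 1%:M.

Lemma constant_block_id (i : 'I_h) (y : 'M[F]_(l i)) : constant_block y i = y.
Proof. by rewrite /constant_block eqxx; apply/matrixP => u v; rewrite mxE /mx_get !valK. Qed.

Lemma constant_blockM (i : 'I_h) (y z : 'M[F]_(l i)) (r : 'I_h) :
  constant_block (y *m z) r = constant_block y r *m constant_block z r.
Proof.
have [->|neq] := eqVneq r i; first by rewrite !constant_block_id.
by rewrite /constant_block (negPf neq : (val r == val i) = false) mulmx1.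
Qed.

Lemma constant_block1 (i r : 'I_h) : constant_block (1%:M : 'M[F]_(l i)) r = 1%:M.
Proof.
have [->|neq] := eqVneq r i; first by rewrite !constant_block_id.
by rewrite /constant_block (negPf neq : (val r == val i) = false).
Qed.

Lemma mxdiagM (B B' : forall r : 'I_h, 'M[F]_(l r)) :
  mxdiag B *m mxdiag B' = mxdiag (fun r => B r *m B' r).
Proof.
rewrite {2}/mxdiag mul_mxdiag_mxblock; apply/eq_mxblockP => r s.
by case: eqVneq => [->|_]; rewrite ?conform_mx_id ?mulmx0.
Qed.

Lemma mxdiag1 : mxdiag (fun r : 'I_h => 1%:M : 'M[F]_(l r)) = 1%:M.
Proof. exact: mxdiagZ. Qed.

Lemma block_diag_mxdiag (B : forall r : 'I_h, 'M[F]_(l r)) : block_diag blkx (mxdiag B).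
Proof. by move=> x y neq; rewrite !mxE (negPf neq : (sg x == sg y) = false) mxE. Qed.

Definition diag_constant i (y : 'M[F]_(l i)) : 'M[F]_n := mxdiag (constant_block y).

Lemma diag_constant1 (i : 'I_h) : diag_constant (1%:M : 'M[F]_(l i)) = 1%:M.
Proof. by rewrite -[RHS]mxdiag1; apply: eq_mxdiag => r; apply: constant_block1. Qed.

Lemma diag_constantM (i : 'I_h) (y z : 'M[F]_(l i)) :
  diag_constant (y *m z) = diag_constant y *m diag_constant z.
Proof. by rewrite [RHS]mxdiagM; apply: eq_mxdiag => r; apply: constant_blockM. Qed.

Lemma talg_a_red (i : 'I_h) (y : 'M[F]_(l i)) :
  red (map_mx polyC (diag_constant y)) = @talg_a F h l i (map_mx polyC y).
Proof.
apply: red_entries => r s u v.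
have -> : map_mx polyC (diag_constant y) (rk u) (rk v) =
   (submxblock (diag_constant y) r s u v)%:P by rewrite !mxE.
have mx_get_map u' v' : mx_get (map_mx polyC y) u' v' = (mx_get y u' v')%:P.
  by rewrite /mx_get; case: insub => // ?; case: insub => // ?; rewrite mxE.
suff E : (submxblock (diag_constant y) r s u v)%:P = @talg_a F h l i (map_mx polyC y) r s u v.
  rewrite -E; split=> //; apply: leq_trans (size_polyC_leq1 _) _; exact: lam_gt0.
rewrite mxblockK [RHS]mxE.
have [ers|neq] := eqVneq r s.
  move: u v; rewrite -ers => u v; rewrite conform_mx_id andbb /constant_block.
  by case: ifP => _; rewrite !mxE ?mx_get_map // val_eqE rmorph_nat.
rewrite mxE polyC0; case: ifP => // /andP[/eqP er /eqP es].
by move/eqP: neq; case; apply: val_inj; rewrite /= er es.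
Qed.

(** The size bound ensures that truncation leaves [1 + f] unchanged. *)
Lemma talg_b_red (i : 'I_h) (x0 : 'I_(l i)) (f : {poly F}) :
  val x0 = 0%N -> (size (1 + f)%R <= lam i)%N ->
  red (elem (rk x0) (rk x0) f) = @talg_b F h l i (1 + f).
Proof.
move=> x00 sz; apply: red_entries => r s u v; rewrite !mxE !eq_rk x00.
have [eri|nri] := eqVneq r i; last first.
  by rewrite (negPf nri : (val r == val i) = false) /= mulr0 addr0; split=> //; apply: size_nat_lam.
have [esi|nsi] := eqVneq s i; last first.
  rewrite (negPf nsi : (val s == val i) = false) /= !andbF mulr0 addr0.
  by split=> //; apply: size_nat_lam.
move: u v; rewrite eri esi => u v; rewrite !eqxx /= /mx_get !valK mxE.
case: (eqVneq (val u) (val v)) => [<-|neq] /=; last first.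
  rewrite add0r size_poly0; split=> //; case: eqP => [u0|]; last by rewrite mulr0.
  by case: eqP => [v0|]; rewrite ?mulr0 //; move: neq; rewrite /= u0 v0.
rewrite andbb; case: eqP => _; rewrite ?mulr1 ?mulr0 ?addr0; split=> //.
by rewrite size_poly1; apply: lam_gt0.
Qed.

(** [X] is given by its entries so that both [talg_cplus] and [talg_cminus] are covered. *)
Lemma talg_c_red (i j : 'I_h) (x : 'I_(l i)) (y : 'I_(l j)) (f : {poly F}) X :
  i != j -> (size f <= lam j)%N ->
  (forall r s u v, X r s u v = ((r == s) && (val u == val v))%:R +
     (if [&& val r == i, val s == j, val u == val x & val v == val y] then f else 0)) ->
  red (elem (rk x) (rk y) f) = X.
Proof.
move=> neq sz Xe; apply: red_entries => r s u v; rewrite Xe !mxE !eq_rk; split.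
  congr (_ + _); rewrite -!val_eqE /=.
  by case: (_ == _); case: (_ == _); case: (_ == _); case: (_ == _); rewrite /= ?mulr1 ?mulr0.
have [ers|_] := eqVneq r s; last first.
  rewrite add0r; case: ifP => [/and4P[_ /eqP e _ _]|_]; last by rewrite size_poly0.
  by rewrite e.
case: ifP => [/and4P[/eqP ri /eqP sj _ _]|_]; last by rewrite addr0; apply: size_nat_lam.
by case/eqP: neq; apply: val_inj; rewrite /= -ri -sj ers.
Qed.

End Flattening.

(** * Transfer to the unit group of the truncated algebra *)

Theorem theorem2p2p4
  (F : finFieldType) (p a : nat) (hp : prime p) (hchar : p \in [pchar F])
  (hq : #|F| = (p ^ a)%N)
  (w : F) (hw : (#|F|.-1).-primitive_root w)
  (h : nat) (hh : (1 <= h)%N) (l lam : nat -> nat)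
  (hl : forall i, (i < h)%N -> (0 < l i)%N)
  (hlam0 : forall i, (i < h)%N -> (0 < lam i)%N)
  (hlam : forall i, (i.+1 < h)%N -> (lam i < lam i.+1)%N)
  (S : forall i : nat, 'M[F]_(l i) -> Prop)
  (hS : forall i, (i < h)%N ->
     (forall y, S i y -> y \in unitmx) /\
     (forall y, y \in unitmx ->
        gen_by (@mulmx F (l i) (l i) (l i)) 1%:M (fun _ => True) (S i) y))
  (U : talg F h l) :
  @talg_unit F h l lam U ->
  gen_by (@talg_mul F h l lam) (@talg_one F h l) (@in_talg F h l lam)
    (fun x =>
       (exists i, exists y, [/\ (i < h)%N, S i y & x = @talg_a F h l i (map_mx polyC y)]) \/
       (exists i j e, [/\ (i < h)%N, (j <= a)%N, (1 <= e <= lam i - 1)%N &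
                        x = @talg_b F h l i (1 + w ^+ j *: 'X^e)]) \/
       (exists i, (i.+1 < h)%N /\ (x = @talg_cplus F h l lam i \/ x = @talg_cminus F h l i)))
    U.
Proof.
set G := gen_by _ _ _ _.
have lam_mono i j : (i <= j < h)%N -> (lam i + j <= lam j + i)%N.
  case/andP; elim: j => [|j IH]; first by rewrite leqn0 => /eqP->.
  rewrite leq_eqVlt ltnS => /orP[/eqP->//|leij] ltj.
  by have := hlam _ ltj; have := IH leij (ltnW ltj); lia.
pose n := (\sum_(r < h) l r)%N.
pose sg (x : 'I_n) := @tagnat.sig1 h (fun r : 'I_h => l r) x.
pose rk (r : 'I_h) u : 'I_n := @tagnat.Rank h (fun r : 'I_h => l r) r u.
pose P (A : 'M[{poly F}]_n) := G (red lam A).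
have sg_rk r u : sg (rk r u) = r by apply: tagnat.Rank1K.
have P1 : P 1%:M by rewrite /P (talg_oneE _ _ hlam0); apply: gen_one.
have PM A B : idealizer (fun x => lam (sg x)) A -> idealizer (fun x => lam (sg x)) B ->
    P A -> P B -> P (A *m B).
  by move=> _ lB pA pB; rewrite /P -(talg_mul_red _ lB); apply: gen_mul.
have PE A B : null (fun x => lam (sg x)) (A - B) -> P A -> P B.
  by move=> /red_eq; rewrite /P => <-.
have PV A B : idealizer (fun x => lam (sg x)) A -> idealizer (fun x => lam (sg x)) B ->
    null (fun x => lam (sg x)) (A *m B - 1%:M) ->
    null (fun x => lam (sg x)) (B *m A - 1%:M) -> P A -> P B.
  move=> lA lB /red_eq eAB /red_eq eBA pA; apply: gen_inv pA _ _ _.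
  - exact: in_talg_red.
  - by rewrite talg_mul_red // eAB talg_oneE.
  - by rewrite talg_mul_red // eBA talg_oneE.
have lam_blk (x y : 'I_n) : (val (sg x) <= val (sg y))%N ->
    (lam (sg x) + val (sg y) <= lam (sg y) + val (sg x))%N.
  by move=> le; apply: lam_mono; rewrite le ltn_ord.
have idealizer_diag (B : forall r : 'I_h, 'M[F]_(l r)) :
    idealizer (fun x => lam (sg x)) (map_mx polyC (mxdiag B)).
  by apply: (idealizer_const lam_blk); apply: block_diag_mxdiag.
(* Generation of the general linear group of one block carries over along the multiplicative map
   [diag_constant]. *)
have P_block (i : 'I_h) (y : 'M[F]_(l i)) : y \in unitmx ->
    P (map_mx polyC (diag_constant h y)).
  have [_ gen_y] := hS i (ltn_ord i); move/gen_y.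
  elim=> {y} [|y Sy|y z _ Py _ Pz|y z _ Py _ yz zy].
  - by rewrite diag_constant1 map_mx1.
  - by rewrite /P talg_a_red //; apply: gen_S; left; exists i, y; split.
  - rewrite diag_constantM map_mxM; apply: PM => //; exact: idealizer_diag.
  - have inv (y' z' : 'M[F]_(l i)) : y' *m z' = 1%:M ->
        null (fun x => lam (sg x)) (map_mx polyC (diag_constant h y') *m
          map_mx polyC (diag_constant h z') - 1%:M).
      move=> yz'; rewrite -map_mxM -diag_constantM yz' diag_constant1 map_mx1 subrr.
      exact: null0.
    by apply: (PV _ _ _ _ _ _ Py); try exact: inv; exact: idealizer_diag.
have P_const (Z Z' : 'M[F]_n) : block_diag (fun x => val (sg x)) Z ->
    block_diag (fun x => val (sg x)) Z' -> Z *m Z' = 1%:M -> P (map_mx polyC Z).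
  move=> bZ bZ' ZZ'.
  have diagE (Y : 'M[F]_n) : block_diag (fun x => val (sg x)) Y ->
      Y = mxdiag (fun r => submxblock Y r r).
    move=> bY; apply/mxblockP => r s; rewrite mxblockK.
    case: eqVneq => [->|neq]; first by rewrite conform_mx_id.
    by apply/matrixP => u v; rewrite !mxE bY // !sg_rk.
  pose f r := submxblock Z r r; pose f' r := submxblock Z' r r.
  have ff' r : f r *m f' r = 1%:M.
    move: r; apply/eq_mxdiagP.
    by rewrite mxdiag1 -(mxdiagM f f') -(diagE _ bZ) -(diagE _ bZ').
  (* A block diagonal matrix is assembled one block at a time, each factor being the identity
     outside its block. *)
  have main k : (k <= h)%N ->
      P (map_mx polyC (mxdiag (fun r : 'I_h => if (r < k)%N then f r else 1%:M))).
    elim: k => [|k IH] lek; first by rewrite mxdiag1 map_mx1.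
    pose i := Ordinal lek.
    have -> : mxdiag (fun r : 'I_h => if (r < k.+1)%N then f r else 1%:M) =
        mxdiag (fun r : 'I_h => if (r < k)%N then f r else 1%:M) *m diag_constant h (f i).
      rewrite [RHS]mxdiagM; apply: eq_mxdiag => r; rewrite ltnS leq_eqVlt.
      have [->|neq] := eqVneq r i; first by rewrite constant_block_id /= eqxx ltnn mul1mx.
      by rewrite /constant_block (negPf neq : (val r == k) = false) mulmx1.
    rewrite map_mxM; apply: PM; do ?[exact: idealizer_diag].
      exact: IH (ltnW lek).
    by apply: P_block; case: (mulmx1_unit (ff' i)).
  rewrite (diagE _ bZ); have := main h (leqnn h); congr (P (map_mx _ _)).
  by apply: eq_mxdiag => r; rewrite ltn_ord.
have P_diag x : exists2 x', val (sg x') = val (sg x) &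
    forall j e, (j <= a)%N -> (0 < e < lam (sg x))%N -> P (elem x' x' (w ^+ j *: 'X^e)).
  (* The first index of the block is where [talg_b] carries its parameter. *)
  exists (rk (sg x) (Ordinal (hl _ (ltn_ord (sg x))))); first by rewrite sg_rk.
  move=> j e lej /andP[e_gt0 lte]; rewrite /P talg_b_red //.
    apply: gen_S; right; left; exists (sg x), j, e; split=> //.
    by rewrite e_gt0; lia.
  apply: leq_trans (size_polyD _ _) _; rewrite geq_max size_poly1 hlam0 //=.
  by apply: leq_trans (size_scale_leq _ _) _; rewrite size_polyXn.
have P_adjacent x y : val (sg y) = (val (sg x)).+1 -> exists x' y',
    [/\ val (sg x') = val (sg x), val (sg y') = val (sg y),
      P (elem x' y' 'X^(lam (sg y') - lam (sg x'))) & P (elem y' x' 1)].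
  move=> exy; have ltx := ltn_ord (sg x); have lty := ltn_ord (sg y).
  have lastx : ((l (sg x)).-1 < l (sg x))%N by rewrite ltn_predL; apply: hl.
  (* The last index of one block and the first of the next are the corners used by [talg_cplus] and
     [talg_cminus]. *)
  pose x' := rk (sg x) (Ordinal lastx); pose y' := rk (sg y) (Ordinal (hl _ lty)).
  have neq : sg x != sg y by rewrite -val_eqE /= exy neq_ltn ltnSn.
  exists x', y'; rewrite !sg_rk; split=> //.
    apply: gen_S; right; right; exists (val (sg x)); rewrite -exy; split=> //; left.
    apply: talg_c_red => //; first by rewrite size_polyXn;
      have := hlam0 _ ltx; have := hlam0 _ lty; lia.
    move=> r s u v; rewrite mxE; congr (_ + _); rewrite -exy /=.
    case: (val r =P val (sg x)) => [/val_inj er|_] //.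
    by case: (val s =P val (sg y)) => [/val_inj es|_] //=; subst r s.
  apply: gen_S; right; right; exists (val (sg x)); rewrite -exy; split=> //; right.
  apply: talg_c_red => //; first by rewrite eq_sym.
    by rewrite size_poly1; apply: hlam0.
  move=> r s u v; rewrite mxE; congr (_ + _); rewrite -exy /=.
  case: (val r =P val (sg y)) => [/val_inj er|_] //.
  by case: (val s =P val (sg x)) => [/val_inj es|_] //=; subst r s.
have between (x y : 'I_n) i : (val (sg x) < i < val (sg y))%N -> exists z, val (sg z) = i.
  case/andP=> _ lti; have lth : (i < h)%N := ltn_trans lti (ltn_ord _).
  by exists (rk (Ordinal lth) (Ordinal (hl _ lth))); rewrite sg_rk.
case=> tU [B [tB [UB BU]]]; rewrite -(unredK tU).
apply: (@P_unit F n (fun x => lam (sg x)) (fun x => val (sg x)) lam_blk P P1 PM PE PV _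
  p a w hchar hq hw between P_const P_diag P_adjacent _ (unred B)).
- by move=> x; apply: hlam0.
- exact: idealizer_unred.
- exact: idealizer_unred.
- by apply: red_null; rewrite -talg_mulE UB talg_oneE.
Qed.
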